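(* Let $(\bar M,\bar g)$ be a 4-dimensional $U(1)$ symmetric Lorentzian spacetime whose metric is expressible, in a suitably aligned coordinate system $(x^0,x^1,x^2,x^3)$, in the form $$\bar g=e^{-2\gamma}g+e^{2\gamma}\,(dx^3+\mathcal A_\alpha dx^\alpha)^2,\qquad \alpha=0,1,2,$$ where the function $\gamma$, the Lorentzian metric $g=g_{\alpha\beta}dx^\alpha dx^\beta$ on the 3-dimensional orbit space, and the 1-form $\mathcal A=\mathcal A_\alpha dx^\alpha$ on the orbit space are smooth and independent of the coordinate $x^3$ corresponding to the $U(1)$ symmetry. Then the Riemann curvature tensor $\overline{\mathrm{Riem}}$ of $\bar g$, and the corresponding (gravitational) Yang-Mills curvature $F$, can be expressed independently of the undifferentiated ''vector potential'' $\mathcal A$. That is, with respect to the adapted orthonormal coframe $\{e^{\hat 0},e^{\hat 1},e^{\hat 2},e^{\hat 3}\}$, all components $\overline{\mathrm{Riem}}^{\hat a}{}_{\hat b\hat c\hat d}$ can be written as expressions in $g$, $\gamma$, the field $\mathcal F=d\mathcal A$, and their derivatives, in which $\mathcal A$ enters only through $\mathcal F$ and derivatives of $\mathcal F$.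
   Context: Adapted orthonormal coframe: put $\tilde g=e^{-2\gamma}g$. The forms $e^{\hat a}=e^{\hat a}{}_\mu dx^\mu$, $\hat a=0,1,2$, $\mu=0,1,2$, are an orthonormal coframe of $\tilde g$ on the orbit space (chosen depending only on $\tilde g$, hence independent of $x^3$ and of $\mathcal A$), and $e^{\hat 3}=e^{\gamma}(dx^3+\mathcal A_\nu dx^\nu)$. $\mathcal F=d\mathcal A$ is the Faraday tensor, $\mathcal F_{\mu\nu}=\partial_\mu\mathcal A_\nu-\partial_\nu\mathcal A_\mu$. Curvature in the Cartan formalism: the connection 1-forms $\Theta^{\hat a}{}_{\hat b}$ of the orthonormal coframe are determined by $de^{\hat a}=-\Theta^{\hat a}{}_{\hat b}\wedge e^{\hat b}$ and antisymmetry of $\Theta_{\hat a\hat b}$. The curvature 2-forms are $\overline{\mathrm{Riem}}^{\hat a}{}_{\hat b}=d\Theta^{\hat a}{}_{\hat b}+\Theta^{\hat a}{}_{\hat c}\wedge\Theta^{\hat c}{}_{\hat b}$. Up to a constant normalization factor, the components $\overline{\mathrm{Riem}}^{\hat a}{}_{\hat b\hat c\hat d}$ are the coefficients of $\overline{\mathrm{Riem}}^{\hat a}{}_{\hat b}$ in the basis $e^{\hat c}\wedge e^{\hat d}$. The gravitational Yang-Mills curvature $F$ is the matrix-valued 2-form $F=(\overline{\mathrm{Riem}}^{\hat a}{}_{\hat b})$. *)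

(* Defs.v *)
From HB Require Import structures.
From mathcomp Require Import all_boot all_order all_algebra.
From mathcomp Require Import all_classical all_reals all_analysis.
From mathcomp Require Import ring.

Set Implicit Arguments.
Unset Strict Implicit.
Unset Printing Implicit Defensive.

Import Order.TTheory GRing.Theory Num.Theory.
Import numFieldNormedType.Exports.

Local Open Scope classical_set_scope.
Local Open Scope ring_scope.

(* Everything is expressed in a coordinate chart: a point is the row vector
   of its coordinates, a tensor field is the function giving its coordinate
   components.  Values of fields outside the open domain are irrelevant. *)

Section Calculus.
Context {R : realType} {n : nat}.
Implicit Types (x : 'rV[R]_n) (i j : 'I_n).

Definition partial i (f : 'rV[R]_n -> R) : 'rV[R]_n -> R :=
  fun x => 'D_(delta_mx 0 i) f x.

(* C^infinity on the open set U: every iterated partial derivative exists and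
   is (Frechet) differentiable, hence continuous, on U. *)
Definition smooth_on (U : set 'rV[R]_n) (f : 'rV[R]_n -> R) : Prop :=
  forall s : seq 'I_n, forall x, U x -> differentiable (foldr partial f s) x.

Definition smooth_mx_on p q (U : set 'rV[R]_n) (T : 'rV[R]_n -> 'M[R]_(p, q)) :
  Prop := forall k l, smooth_on U (fun x => T x k l).

(* A 1-form w_i dx^i is the row vector (w_i); a 2-form is the antisymmetric
   matrix (w_ij) with w = (1/2) w_ij dx^i /\ dx^j. *)
Definition wedge (v w : 'rV[R]_n) : 'M[R]_n :=
  \matrix_(i, j) (v 0 i * w 0 j - v 0 j * w 0 i).

Definition extd (w : 'rV[R]_n -> 'rV[R]_n) : 'rV[R]_n -> 'M[R]_n := fun x =>
  \matrix_(i, j) (partial i (fun y => w y 0 j) x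
                  - partial j (fun y => w y 0 i) x).

End Calculus.

Section Cartan.
Context {R : realType} {n : nat}.

(* signature (-, +, ..., +), index 0 being the timelike one *)
Definition minkowski : 'M[R]_n :=
  diag_mx (\row_(a < n) (if val a == 0%N then -1 else 1)).

Definition lorentzian (g : 'M[R]_n) : Prop :=
  g^T = g /\ exists2 P : 'M[R]_n, P \in unitmx & P^T *m g *m P = minkowski.

(* Row a of the matrix e x is the coframe 1-form e^a at x, so that
   e x a i = e^a_i; orthonormality reads g_ij = eta_ab e^a_i e^b_j. *)
Definition orthonormal_coframe (U : set 'rV[R]_n) (g e : 'rV[R]_n -> 'M[R]_n) :
  Prop :=
  forall x, U x -> e x \in unitmx /\ g x = (e x)^T *m minkowski *m e x.

(* Theta x a b is the 1-form Theta^a_b at x. *)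
Definition connection_forms (U : set 'rV[R]_n) (e : 'rV[R]_n -> 'M[R]_n)
    (Theta : 'rV[R]_n -> 'I_n -> 'I_n -> 'rV[R]_n) : Prop :=
  forall x, U x ->
    (forall a, extd (fun y => row a (e y)) x
               = - \sum_b wedge (Theta x a b) (row b (e x))) /\
    (forall a b, \sum_c minkowski a c *: Theta x c b
                 = - \sum_c minkowski b c *: Theta x c a).

(* The matrix-valued 2-form F = (Riem^a_b), i.e. the gravitational Yang-Mills
   curvature: F^a_b = d Theta^a_b + Theta^a_c /\ Theta^c_b. *)
Definition ym_curvature (Theta : 'rV[R]_n -> 'I_n -> 'I_n -> 'rV[R]_n) :
  'rV[R]_n -> 'I_n -> 'I_n -> 'M[R]_n := fun x a b =>
  extd (fun y => Theta y a b) x + \sum_c wedge (Theta x a c) (Theta x c b).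

(* riemann_components U g e Riem: e is an orthonormal coframe of g over U, and
   Riem a b c d x = Riem^a_bcd are the coefficients, in the basis e^c /\ e^d
   with c < d, of the curvature 2-forms of its connection, extended
   antisymmetrically to all (c, d).  The connection forms are unique over U:
   see connection_forms_unique below. *)
Definition riemann_components (U : set 'rV[R]_n) (g e : 'rV[R]_n -> 'M[R]_n)
    (Riem : 'I_n -> 'I_n -> 'I_n -> 'I_n -> 'rV[R]_n -> R) : Prop :=
  orthonormal_coframe U g e /\
  exists2 Theta, connection_forms U e Theta &
    forall x, U x -> forall a b,
      (forall c d, Riem a b c d x = - Riem a b d c x) /\
      ym_curvature Theta x a b =
        \sum_(c < n) \sum_(d < n | (c < d)%N)
          Riem a b c d x *: wedge (row c (e x)) (row d (e x)).

End Cartan.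

Section U1Symmetry.
Context {R : realType}.

(* The orbit space has coordinates (x^0, x^1, x^2) in 'rV_3; the spacetime has
   coordinates (x^0, x^1, x^2, x^3) in 'rV_(3 + 1), and the projection along
   the U(1) orbits is lsubmx.  Fields independent of x^3 are fields on 'rV_3. *)
Implicit Types (gamma : 'rV[R]_3 -> R) (g e : 'rV[R]_3 -> 'M[R]_3)
  (A : 'rV[R]_3 -> 'rV[R]_3).

Definition rescaled_metric gamma g : 'rV[R]_3 -> 'M[R]_3 :=
  fun y => expR (- 2 * gamma y) *: g y.

Definition spacetime_metric gamma g A : 'rV[R]_(3 + 1) -> 'M[R]_(3 + 1) :=
  fun x => let y := lsubmx x in
    let theta : 'rV[R]_(3 + 1) := row_mx (A y) 1%:M in (* dx^3 + A_a dx^a *)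
    expR (- 2 * gamma y) *: block_mx (g y) 0 0 0
    + expR (2 * gamma y) *: (theta^T *m theta).

Definition adapted_coframe gamma A e : 'rV[R]_(3 + 1) -> 'M[R]_(3 + 1) :=
  fun x => let y := lsubmx x in
    col_mx (row_mx (e y) 0) (expR (gamma y) *: row_mx (A y) 1%:M).

(* Formal differential expressions in the components of g, gamma, the
   Faraday field and the orthonormal coframe of e^(-2 gamma) g.  There is no
   symbol for the vector potential. *)
Inductive dexpr : Type :=
| DConst of R
| DMetric of 'I_3 & 'I_3
| DGamma
| DFaraday of 'I_3 & 'I_3
| DFrame of 'I_3 & 'I_3
| DAdd of dexpr & dexpr
| DMul of dexpr & dexpr
| DInv of dexpr
| DExp of dexpr
| DPartial of 'I_3 & dexpr.

(* frame is the rule choosing the coframe as a function of the rescaled metric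
   alone, so the value of an expression is a function of gamma, g and F. *)
Fixpoint deval (frame : ('rV[R]_3 -> 'M[R]_3) -> 'rV[R]_3 -> 'M[R]_3)
    gamma g (F : 'rV[R]_3 -> 'M[R]_3) (E : dexpr) : 'rV[R]_3 -> R :=
  match E with
  | DConst c => fun=> c
  | DMetric i j => fun y => g y i j
  | DGamma => gamma
  | DFaraday i j => fun y => F y i j
  | DFrame a i => fun y => frame (rescaled_metric gamma g) y a i
  | DAdd E1 E2 =>
      fun y => deval frame gamma g F E1 y + deval frame gamma g F E2 y
  | DMul E1 E2 =>
      fun y => deval frame gamma g F E1 y * deval frame gamma g F E2 y
  | DInv E1 => fun y => (deval frame gamma g F E1 y)^-1
  | DExp E1 => fun y => expR (deval frame gamma g F E1 y)
  | DPartial i E1 => partial i (deval frame gamma g F E1)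
  end.

End U1Symmetry.

Arguments dexpr R : clear implicits.

Section Uniqueness.
Context {R : realType} {n : nat}.

Lemma minkowskiE (a b : 'I_n) : (minkowski : 'M[R]_n) a b =
  (if val a == 0%N then -1 else 1) *+ (a == b).
Proof. by rewrite /minkowski !mxE. Qed.

Lemma connection_forms_unique (U : set 'rV[R]_n) (g e : 'rV[R]_n -> 'M[R]_n)
    Theta Theta' :
  orthonormal_coframe U g e ->
  connection_forms U e Theta -> connection_forms U e Theta' ->
  forall x, U x -> forall a b, Theta x a b = Theta' x a b.
Proof.
move=> one C C' x Ux.
have [eu _] := one x Ux.
have [S T] := C x Ux; have [S' T'] := C' x Ux.
pose s (a : 'I_n) : R := if val a == 0%N then -1 else 1.
have s2 a : s a * s a = 1 by rewrite /s; case: ifP; rewrite ?mulrNN mulr1.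
have sumE (X : 'I_n -> 'rV[R]_n) a : \sum_c minkowski a c *: X c = s a *: X a.
  rewrite (bigD1 a)//= big1 ?addr0 => [|c ca]; rewrite minkowskiE.
    by rewrite eqxx mulr1n.
  by rewrite [a == c]eq_sym (negbTE ca) mulr0n scale0r.
pose G a b := Theta x a b - Theta' x a b.
pose D a b c : R := s a * (G a b *m invmx (e x)) 0 c.
have asym a b c : D a b c = - D b a c.
  have : s a *: G a b = - (s b *: G b a).
    rewrite /G !scalerBr -!(sumE (fun c => Theta x c _)).
    rewrite -!(sumE (fun c => Theta' x c _)).
    by rewrite T T' opprB opprK addrC.
  move=> /(congr1 (fun v => (v *m invmx (e x)) 0 c)).
  by rewrite /D /= mulNmx -!scalemxAl !mxE.
have sym a b c : D a b c = D a c b.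
  have W : \sum_b wedge (G a b) (row b (e x)) = 0.
    have := S' a; rewrite S => /eqP; rewrite eqr_opp -subr_eq0 -sumrB => /eqP H.
    rewrite -[RHS]H; apply: eq_bigr => b' _; apply/matrixP => i j; rewrite !mxE.
    by ring.
  pose Q : 'M[R]_n := \matrix_(b', i) G a b' 0 i.
  have Qe : Q^T *m e x - (Q^T *m e x)^T = 0.
    apply/matrixP => i j; have := congr1 (fun M : 'M[R]_n => M i j) W.
    rewrite summxE [X in _ = X]mxE => H.
    rewrite !mxE -[RHS]H -sumrB; apply: eq_bigr => k _.
    by rewrite !mxE.
  have Qs : Q *m invmx (e x) = (Q *m invmx (e x))^T.
    move/eqP: Qe; rewrite subr_eq0 => /eqP.
    rewrite trmx_mul trmxK.
    move=> /(congr1 (fun M => (invmx (e x))^T *m M *m invmx (e x))).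
    rewrite -!mulmxA mulmxV// mulmx1 !mulmxA.
    rewrite -(trmx_mul (e x)) mulmxV// trmx1 mul1mx => H.
    by rewrite -[LHS]H trmx_mul.
  have DE b' c' : (G a b' *m invmx (e x)) 0 c' = (Q *m invmx (e x)) b' c'.
    by rewrite !mxE; apply: eq_bigr => k _; rewrite !mxE.
  by rewrite /D !DE {1}Qs [in LHS]mxE.
have D0 a b c : D a b c = 0.
  have : D a b c = - D a b c.
    by rewrite {1}sym asym sym asym opprK sym {1}asym.
  by move=> /eqP; rewrite eq_sym eqNr => /eqP.
move=> a b; apply/eqP; rewrite -subr_eq0; apply/eqP; rewrite -/(G a b).
rewrite -[G a b](mulmxKV eu).
suff -> : G a b *m invmx (e x) = 0 by rewrite mul0mx.
apply/rowP => c; rewrite [RHS]mxE.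
by rewrite -[LHS]mul1r -(s2 a) -mulrA -/(D a b c) D0 mulr0.
Qed.

End Uniqueness.

(* Main.v *)
Require Import Defs.
From HB Require Import structures.
From mathcomp Require Import all_boot all_order all_algebra.
From mathcomp Require Import all_classical all_reals all_analysis.
From mathcomp Require Import perm ring.

(** Contract everything with the coframe.  If
      de^a = (1/2) C^a_bc e^b /\ e^c,
    then the connection components om_abc, where Theta^a_b = om^a_bc e^c, are
    the constant-coefficient combinations of the structure functions C given
    by the Koszul formula, and the curvature components are
      e_c(om^a_bd) - e_d(om^a_bc) + om^a_bf C^f_cd
        + om^a_fc om^f_bd - om^a_fd om^f_bc,
    where e_c is the c-th vector of the dual frame.  So only two things can
    carry the potential into the curvature: the structure functions and the
    frame derivatives e_c.

    For the adapted coframe neither does.  The forms e^0, e^1, e^2 live on the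
    orbit space, so their structure functions are those of the 3-dimensional
    coframe.  For e^3 = e^gamma (dx^3 + A),
      de^3 = dgamma /\ e^3 + e^gamma F,  F = dA,
    whose components are e_b(gamma) and e^gamma F(e_b, e_c).  The dual frame
    vectors do involve A, since e_c contains - A(e_c) d/dx^3 for c < 3, but
    this term kills every function independent of x^3; and all structure
    functions are independent of x^3, hence inductively so is everything built
    from them.

    The reduction of the curvature to C holds for a coframe in any dimension
    ([riemann_moving_frame]).  It never mentions the dual frame: the frame
    derivatives D_c f are characterised by df = (D_c f) e^c.  The
    A-free formulas are written as formal expressions ([dstruct],
    [dconnection], [driemann]); the 3-dimensional dual frame they need is the
    inverse of the coframe matrix, expressed by Cramer's rule.  What remains is
    to check the structure equations of the adapted coframe
    ([adapted_structure]), the formula for frame derivatives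
    ([partial_adapted]), and that the connection components are differentiable
    so that the Leibniz rule applies ([ddiff_dconnection]). *)

Set Implicit Arguments.
Unset Strict Implicit.
Unset Printing Implicit Defensive.

Import Order.TTheory GRing.Theory Num.Theory.
Import numFieldNormedType.Exports.

Local Open Scope classical_set_scope.
Local Open Scope ring_scope.

(* The unqualified name would refer to the Minkowski inequality. *)
Local Notation minkowski := Defs.minkowski.

(** * Two-forms in a basis of one-forms *)

Section Wedge.
Context {R : realType} {n : nat}.
Implicit Types (u v : 'rV[R]_n) (P W : 'M[R]_n).

Lemma wedgeE u v : wedge u v = u^T *m v - v^T *m u.
Proof.
by apply/matrixP => i j; rewrite !mxE !big_ord1 !mxE [v 0 i * _]mulrC.
Qed.

(** The antisymmetric matrix of a 2-form changes basis by congruence; every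
    passage between coordinate and coframe components below rests on this. *)
Lemma wedgeMr u v P : wedge (u *m P) (v *m P) = P^T *m wedge u v *m P.
Proof. by rewrite !wedgeE !trmx_mul mulmxBr mulmxBl !mulmxA. Qed.

Lemma wedge_delta (c d i j : 'I_n) :
  wedge (delta_mx 0 c) (delta_mx 0 d) i j =
    ((i == c) && (j == d))%:R - ((j == c) && (i == d))%:R :> R.
Proof. by rewrite !mxE !eqxx /= -!natrM !mulnb. Qed.

(** This turns a coefficient matrix into the sum over c < d that occurs in the
    definition of the curvature components. *)
Lemma antisym_wedge_sum W : W^T = - W ->
  W = \sum_(c < n) \sum_(d < n | (c < d)%N)
        W c d *: wedge (delta_mx 0 c) (delta_mx 0 d).
Proof.
move=> WN; have WNE k l : W k l = - W l k.
  by have /matrixP/(_ l k) := WN; rewrite !mxE.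
have W0 k : W k k = 0 by apply/eqP; rewrite -eqNr -WNE.
pose T (k l : 'I_n) : R := if (k < l)%N then W k l else 0.
have sumT k l : \sum_(c < n) \sum_(d < n | (c < d)%N)
    W c d * ((k == c) && (l == d))%:R = T k l.
  rewrite (bigD1 k)//= [X in _ + X]big1 ?addr0; last first.
    by move=> c /negbTE ck; rewrite big1// => d _; rewrite eq_sym ck mulr0.
  rewrite big_mkcond (bigD1 l)//= [X in _ + X]big1 ?addr0 ?eqxx ?mulr1//.
  by move=> d /negbTE dl; rewrite [l == d]eq_sym dl andbF mulr0; case: ifP.
apply/matrixP => i j; rewrite summxE.
under eq_bigr => c _ do rewrite summxE.
under eq_bigr => c _ do
  under eq_bigr => d _ do rewrite mxE wedge_delta mulrBr.
under eq_bigr => c _ do rewrite sumrB.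
rewrite sumrB !sumT /T; case: (ltngtP i j) => [ij|ji|/val_inj ->].
- by rewrite subr0.
- by rewrite sub0r -WNE.
- by rewrite subr0 W0.
Qed.

End Wedge.

(** * Cartan's equations in a moving coframe *)

Section MovingFrame.
Context {R : realType} {n : nat}.

(** Leibniz rule d(u_a e^a) = du_a /\ e^a + u_a de^a in coframe components.
    The matrix [du] holds the frame derivatives D_c u_a, specified by
    du_a = (D_c u_a) e^c rather than through the dual frame. *)
Lemma extd_frame_comb (e : 'rV[R]_n -> 'M[R]_n) (u : 'rV[R]_n -> 'rV[R]_n)
    (du : 'M[R]_n) (C : 'I_n -> 'M[R]_n) (x : 'rV[R]_n) :
  (forall a i, differentiable (fun y => e y a i) x) ->
  (forall a, differentiable (fun y => u y 0 a) x) ->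
  (forall i a, partial i (fun y => u y 0 a) x = ((e x)^T *m du) i a) ->
  (forall a, extd (fun y => row a (e y)) x = (e x)^T *m C a *m e x) ->
  extd (fun y => u y *m e y) x =
    (e x)^T *m (du - du^T + \sum_a u x 0 a *: C a) *m e x.
Proof.
move=> de dudiff duE CE.
have -> : (e x)^T *m (du - du^T + \sum_a u x 0 a *: C a) *m e x =
    (e x)^T *m du *m e x - ((e x)^T *m du *m e x)^T
    + \sum_a u x 0 a *: extd (fun y => row a (e y)) x.
  rewrite !trmx_mul trmxK mulmxDr mulmxDl mulmxBr mulmxBl mulmxA; congr (_ + _).
  rewrite mulmx_sumr mulmx_suml; apply: eq_bigr => a _.
  by rewrite CE -scalemxAr -scalemxAl.
have pE i j : partial i (fun y => (u y *m e y) 0 j) x =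
    ((e x)^T *m du *m e x) i j
    + \sum_a u x 0 a * partial i (fun y => e y a j) x.
  have -> : (fun y => (u y *m e y) 0 j) =
      \sum_a ((fun y => u y 0 a) * (fun y => e y a j)).
    by apply/funext => y; rewrite !mxE fct_sumE.
  rewrite /partial derive_sum; last first.
    by move=> a; apply: derivableM; exact: diff_derivable.
  rewrite [in RHS]mxE -big_split/=; apply: eq_bigr => a _.
  rewrite deriveM; try exact: diff_derivable.
  rewrite -[in RHS]duE addrC; congr (_ + _).
  by rewrite /partial -[LHS]/(_ * _) mulrC.
move: (_ *m du *m e x) pE => M pE.
apply/matrixP => i j; rewrite [LHS]mxE !pE !mxE summxE.
rewrite opprD addrACA -sumrB; congr (_ + _); apply: eq_bigr => a _.
rewrite -mulrBr !mxE; congr (_ * (_ - _)); congr (partial _ _ _);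
  by apply/funext => y; rewrite mxE.
Qed.

Definition eta_sign (a : 'I_n) : R := if val a == 0%N then -1 else 1.

Lemma eta_signK a : eta_sign a * eta_sign a = 1.
Proof. by rewrite /eta_sign; case: ifP; rewrite ?mulrNN mulr1. Qed.

Lemma minkowski_sum (V : lmodType R) (X : 'I_n -> V) a :
  \sum_c minkowski a c *: X c = eta_sign a *: X a.
Proof.
rewrite (bigD1 a)//= big1 ?addr0 => [|c ca]; rewrite minkowskiE.
  by rewrite eqxx mulr1n.
by rewrite [a == c]eq_sym (negbTE ca) mulr0n scale0r.
Qed.

(** Koszul formula for the connection coefficients om^a_bc in an orthonormal
    coframe; the factors [eta_sign] lower and raise indices.  The sum is
    arranged as in [dconnection], which makes the two agree by
    computation. *)
Definition koszul (C : 'I_n -> 'I_n -> 'I_n -> R) (a b c : 'I_n) : R :=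
  eta_sign a * (2^-1 * (eta_sign a * C a b c +
    (-1) * (eta_sign b * C b a c + eta_sign c * C c a b))).

Lemma koszul_antisym (C : 'I_n -> 'I_n -> 'I_n -> R) a b c :
  (forall k l m, C k l m = - C k m l) ->
  eta_sign a * koszul C a b c = - (eta_sign b * koszul C b a c).
Proof.
move=> CN; rewrite /koszul !mulrA !eta_signK !mul1r [C c b a]CN; ring.
Qed.

(** The first structure equation de^a = - Theta^a_b /\ e^b in components. *)
Lemma koszul_torsion (C : 'I_n -> 'I_n -> 'I_n -> R) a b c :
  (forall k l m, C k l m = - C k m l) ->
  koszul C a b c - koszul C a c b = C a b c.
Proof.
move=> CN; rewrite /koszul [C a c b]CN.
transitivity (eta_sign a * eta_sign a * C a b c); last first.
  by rewrite eta_signK mul1r.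
by field.
Qed.

Definition frame_curvature (om : 'I_n -> 'I_n -> 'I_n -> R)
    (Dom : 'I_n -> 'I_n -> 'I_n -> 'I_n -> R) (C : 'I_n -> 'I_n -> 'I_n -> R)
    (a b c d : 'I_n) : R :=
  (Dom c a b d - Dom d a b c) + (\sum_f om a b f * C f c d +
  \sum_f (om a f c * om f b d - om a f d * om f b c)).

Lemma frame_curvature_antisym om Dom (C : 'I_n -> 'I_n -> 'I_n -> R) a b c d :
  (forall k l m, C k l m = - C k m l) ->
  frame_curvature om Dom C a b c d = - frame_curvature om Dom C a b d c.
Proof.
move=> CN; rewrite /frame_curvature !opprD opprK -!sumrN [in LHS]addrC.
rewrite [in RHS]addrC; congr (_ + _ + _); last by rewrite addrC.
  by apply: eq_bigr => f _; rewrite CN mulrN.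
by apply: eq_bigr => f _; rewrite opprB.
Qed.

(** The Koszul coefficients satisfy both conditions on the connection forms,
    and the components of dTheta + Theta /\ Theta are read off by conjugating
    everything with the coframe: each 2-form in sight is e^T W e for a
    matrix W of coframe components, and the formula for the curvature becomes
    an identity between the matrices W. *)
Lemma riemann_moving_frame (V : set 'rV[R]_n) (g e : 'rV[R]_n -> 'M[R]_n)
    (C : 'I_n -> 'I_n -> 'I_n -> 'rV[R]_n -> R)
    (om : 'I_n -> 'I_n -> 'I_n -> 'rV[R]_n -> R)
    (Dom : 'I_n -> 'I_n -> 'I_n -> 'I_n -> 'rV[R]_n -> R) :
  orthonormal_coframe V g e ->
  (forall x a i, V x -> differentiable (fun y => e y a i) x) ->
  (forall x a b c, V x -> C a b c x = - C a c b x) ->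
  (forall x a, V x -> extd (fun y => row a (e y)) x =
     (e x)^T *m \matrix_(b, c) C a b c x *m e x) ->
  (forall x a b c, V x -> om a b c x = koszul (fun k l m => C k l m x) a b c) ->
  (forall x a b c, V x -> differentiable (om a b c) x) ->
  (forall x a b c i, V x ->
     partial i (om a b c) x = \sum_d e x d i * Dom d a b c x) ->
  riemann_components V g e (fun a b c d x =>
    frame_curvature (fun k l m => om k l m x) (fun k l m p => Dom k l m p x)
      (fun k l m => C k l m x) a b c d).
Proof.
move=> eo ediff CN CE omE omdiff DomE; split=> //.
pose u a b x : 'rV[R]_n := \row_c om a b c x.
exists (fun x a b => u a b x *m e x) => [x Vx|x Vx a b].
  split=> [a|a b].
    rewrite CE// -mulmxA -sumrN.
    under eq_bigr => b _ do rewrite rowE wedgeMr -mulNmx -mulmxN -mulmxA.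
    rewrite -mulmx_sumr -mulmx_suml; congr (_ *m (_ *m _)).
    apply/matrixP => c d; rewrite !mxE summxE.
    rewrite -(koszul_torsion a c d (fun k l m => CN x k l m Vx)) -!omE//.
    under eq_bigr => b _ do rewrite !mxE eqxx/= opprB.
    rewrite sumrB; congr (_ - _).
      rewrite (bigD1 c)//= eqxx mulr1 big1 ?addr0// => b /negbTE.
      by rewrite eq_sym => ->; rewrite mulr0.
    rewrite (bigD1 d)//= eqxx mulr1 big1 ?addr0// => b /negbTE.
    by rewrite eq_sym => ->; rewrite mulr0.
  rewrite !minkowski_sum !scalemxAl -mulNmx; congr (_ *m _).
  apply/rowP => c; rewrite !mxE !omE//.
  exact: koszul_antisym (fun k l m => CN x k l m Vx).
have CNx k l m : C k l m x = - C k m l x by exact: CN.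
split=> [c d|]; first exact: frame_curvature_antisym.
rewrite /ym_curvature.
have uE c : (fun y => u a b y 0 c) = om a b c.
  by apply/funext => y; rewrite mxE.
rewrite (@extd_frame_comb e (u a b) (\matrix_(c, d) Dom c a b d x)
  (fun k => \matrix_(c, d) C k c d x)).
- have -> : \sum_c wedge (u a c x *m e x) (u c b x *m e x) =
      (e x)^T *m (\sum_c wedge (u a c x) (u c b x)) *m e x.
    by rewrite mulmx_sumr mulmx_suml; apply: eq_bigr => c _; rewrite wedgeMr.
  rewrite -mulmxDl -mulmxDr.
  set W := (X in _ *m X *m _).
  have WE c d : W c d = frame_curvature (fun k l m => om k l m x)
      (fun k l m p => Dom k l m p x) (fun k l m => C k l m x) a b c d.
    rewrite /frame_curvature !mxE !summxE !addrA; congr (_ + _ + _).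
      by apply: eq_bigr => f _; rewrite !mxE.
    by apply: eq_bigr => f _; rewrite !mxE.
  have WN : W^T = - W.
    apply/matrixP => c d; rewrite mxE [RHS]mxE !WE.
    exact: frame_curvature_antisym.
  rewrite [in LHS](antisym_wedge_sum WN) mulmx_sumr mulmx_suml.
  apply: eq_bigr => c _; rewrite mulmx_sumr mulmx_suml.
  apply: eq_bigr => d _.
  by rewrite -scalemxAr -scalemxAl -wedgeMr -!rowE WE.
- by move=> k i; exact: ediff.
- by move=> c; rewrite uE; exact: omdiff.
- move=> i c; rewrite uE DomE// !mxE.
  by apply: eq_bigr => d _; rewrite !mxE.
- by move=> k; exact: CE.
Qed.

End MovingFrame.

(** * Functions and forms independent of the last coordinate *)

Section Pullback.
Context {R : realType} {m : nat}.

(** The two difference quotients are the same function of the increment. *)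
Lemma derive_lsubmx p (f : 'rV[R]_m -> R) (x v : 'rV[R]_(m + p)) :
  'D_v (f \o lsubmx) x = 'D_(lsubmx v) f (lsubmx x).
Proof.
rewrite /derive; set d := (fun h => _); set d' := (fun h => _).
suff -> : d = d' by [].
by apply/funext => h; rewrite /d /d' /=; congr (_ *: (f _ - _));
  apply/rowP => j; rewrite !mxE.
Qed.

Lemma partial_lsubmx_l p (f : 'rV[R]_m -> R) (x : 'rV[R]_(m + p)) i :
  partial (lshift p i) (f \o lsubmx) x = partial i f (lsubmx x).
Proof.
rewrite /partial derive_lsubmx; congr ('D_ _ f _).
by apply/rowP => j; rewrite !mxE eq_lshift.
Qed.

Lemma partial_lsubmx_r p (f : 'rV[R]_m -> R) (x : 'rV[R]_(m + p)) i :
  partial (rshift m i) (f \o lsubmx) x = 0.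
Proof.
rewrite /partial derive_lsubmx.
suff -> : lsubmx (delta_mx 0 (rshift m i)) = 0 :> 'rV[R]_m by rewrite derive0.
by apply/rowP => j; rewrite !mxE eq_lrshift andbF.
Qed.

(** If the coefficients of w + f dt do not depend on t, its exterior derivative
    is dw + df /\ dt; here t is the last coordinate. *)
Lemma extd_lsubmx (w : 'rV[R]_m -> 'rV[R]_(m + 1)) (x : 'rV[R]_(m + 1)) :
  let y := lsubmx x in
  let dw3 := \col_i partial i (fun z => rsubmx (w z) 0 0) y in
  extd (fun x => w (lsubmx x)) x =
    block_mx (extd (fun z => lsubmx (w z)) y) dw3 (- dw3^T) 0.
Proof.
move=> y dw3.
have wl j : (fun x => w (lsubmx x) 0 (lshift 1 j)) =
    (fun z => lsubmx (w z) 0 j) \o (@lsubmx R 1 m 1).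
  by apply/funext => z /=; rewrite [RHS]mxE.
have wr j : (fun x => w (lsubmx x) 0 (rshift m j)) =
    (fun z => rsubmx (w z) 0 0) \o (@lsubmx R 1 m 1).
  by apply/funext => z /=; rewrite [RHS]mxE (ord1 j).
apply/matrixP => i j; rewrite [LHS]mxE.
case: (split_ordP i) => i' ->; case: (split_ordP j) => j' ->;
  rewrite ?wl ?wr ?partial_lsubmx_l ?partial_lsubmx_r.
- by rewrite block_mxEul mxE.
- by rewrite block_mxEur mxE subr0.
- by rewrite block_mxEdl !mxE sub0r.
- by rewrite block_mxEdr mxE subr0.
Qed.

Lemma differentiable_expR_comp (f : 'rV[R]_m -> R) y : differentiable f y ->
  differentiable (fun z => expR (f z)) y.
Proof.
move=> df; apply: (@differentiable_comp _ _ _ _ f expR) => //.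
exact/derivable1_diffP/derivable_expR.
Qed.

Lemma partial_expR (f : 'rV[R]_m -> R) y i : differentiable f y ->
  partial i (fun z => expR (f z)) y = expR (f y) * partial i f y.
Proof.
move=> df; have de : differentiable (expR : R -> R) (f y).
  exact/derivable1_diffP/derivable_expR.
rewrite /partial !deriveE//; last exact: differentiable_comp.
rewrite (diff_comp df de) /= diff1E//= derive1E derive_val.
by rewrite -[LHS]/(_ * _) mulrC.
Qed.

Lemma extd_expR_scale (f : 'rV[R]_m -> R) (w : 'rV[R]_m -> 'rV[R]_m) y :
  differentiable f y -> (forall j, differentiable (fun z => w z 0 j) y) ->
  extd (fun z => expR (f z) *: w z) y =
    expR (f y) *: (extd w y + wedge (\row_i partial i f y) (w y)).
Proof.
move=> df dw; have def := differentiable_expR_comp df.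
have pE i j : partial i (fun z => (expR (f z) *: w z) 0 j) y =
    expR (f y) * partial i (fun z => w z 0 j) y
    + expR (f y) * partial i f y * w y 0 j.
  have -> : (fun z => (expR (f z) *: w z) 0 j) =
      (fun z => expR (f z)) * (fun z => w z 0 j).
    by apply/funext => z; rewrite mxE.
  rewrite /partial deriveM; try exact: diff_derivable.
  congr (_ + _); rewrite -[RHS]mulrC; congr (_ * _).
  exact: partial_expR.
apply/matrixP => i j; rewrite mxE !pE !mxE; ring.
Qed.

End Pullback.

(** * Linear algebra with formal differential expressions *)

Section Expressions.
Context {R : realType}.

Definition dsub E1 E2 : dexpr R := DAdd E1 (DMul (DConst (-1)) E2).

Definition dsum (I : finType) (f : I -> dexpr R) : dexpr R :=
  foldr (fun i => DAdd (f i)) (DConst 0) (index_enum I).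

Definition dprod (I : finType) (f : I -> dexpr R) : dexpr R :=
  foldr (fun i => DMul (f i)) (DConst 1) (index_enum I).

Definition dmulmx m n p (M : 'M[dexpr R]_(m, n)) (N : 'M[dexpr R]_(n, p)) :
  'M[dexpr R]_(m, p) := \matrix_(i, j) dsum (fun k => DMul (M i k) (N k j)).

Definition ddet n (M : 'M[dexpr R]_n) : dexpr R :=
  dsum (fun s : 'S_n => DMul (DConst ((-1) ^+ s)) (dprod (fun i => M i (s i)))).

(** Cramer's rule; it agrees with [invmx] where the determinant is nonzero. *)
Definition dinvmx n (M : 'M[dexpr R]_n) : 'M[dexpr R]_n :=
  \matrix_(i, j) DMul (DInv (ddet M))
    (DMul (DConst ((-1) ^+ (j + i))) (ddet (row' j (col' i M)))).

Context (frame : ('rV[R]_3 -> 'M[R]_3) -> 'rV[R]_3 -> 'M[R]_3)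
  (gamma : 'rV[R]_3 -> R) (g F : 'rV[R]_3 -> 'M[R]_3).
Local Notation ev E := (deval frame gamma g F E).

Lemma deval_sub E1 E2 y : ev (dsub E1 E2) y = ev E1 y - ev E2 y.
Proof. by rewrite /= mulN1r. Qed.

Lemma deval_sum (I : finType) (f : I -> dexpr R) y :
  ev (dsum f) y = \sum_i ev (f i) y.
Proof.
rewrite /dsum; elim: (index_enum I) => [|i r IH] /=; first by rewrite big_nil.
by rewrite big_cons IH.
Qed.

Lemma deval_prod (I : finType) (f : I -> dexpr R) y :
  ev (dprod f) y = \prod_i ev (f i) y.
Proof.
rewrite /dprod; elim: (index_enum I) => [|i r IH] /=; first by rewrite big_nil.
by rewrite big_cons IH.
Qed.

(** Expressions are collected in matrices so that index computations reduce to
    the matrix algebra of their values. *)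
Definition devalmx m n (M : 'M[dexpr R]_(m, n)) (y : 'rV[R]_3) : 'M[R]_(m, n) :=
  map_mx (fun E => ev E y) M.

Lemma deval_mulmx m n p (M : 'M[dexpr R]_(m, n)) (N : 'M[dexpr R]_(n, p)) y :
  devalmx (dmulmx M N) y = devalmx M y *m devalmx N y.
Proof.
apply/matrixP => i j; rewrite !mxE deval_sum.
by apply: eq_bigr => k _; rewrite !mxE.
Qed.

Lemma deval_det n (M : 'M[dexpr R]_n) y : ev (ddet M) y = \det (devalmx M y).
Proof.
rewrite deval_sum; apply: eq_bigr => s _ /=; rewrite deval_prod.
by congr (_ * _); apply: eq_bigr => i _; rewrite mxE.
Qed.

Lemma deval_invmx n (M : 'M[dexpr R]_n) y : devalmx M y \in unitmx ->
  devalmx (dinvmx M) y = invmx (devalmx M y).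
Proof.
move=> Mu; rewrite /invmx Mu; apply/matrixP => i j; rewrite !mxE /= !deval_det.
by rewrite /cofactor /devalmx map_row' map_col'.
Qed.

Definition ddiff y E := differentiable (ev E) y.

Lemma ddiffD y E1 E2 : ddiff y E1 -> ddiff y E2 -> ddiff y (DAdd E1 E2).
Proof. exact: differentiableD. Qed.

Lemma ddiffM y E1 E2 : ddiff y E1 -> ddiff y E2 -> ddiff y (DMul E1 E2).
Proof. exact: differentiableM. Qed.

Lemma ddiffC y c : ddiff y (DConst c).
Proof. exact: differentiable_cst. Qed.

Lemma ddiff_sub y E1 E2 :
  ddiff y E1 -> ddiff y E2 -> ddiff y (dsub E1 E2).
Proof.
move=> ? ?; apply: ddiffD => //; apply: ddiffM => //; exact: ddiffC.
Qed.

Lemma ddiff_sum y (I : finType) (f : I -> dexpr R) :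
  (forall i, ddiff y (f i)) -> ddiff y (dsum f).
Proof.
move=> fy; rewrite /dsum; elim: (index_enum I) => [|i r IH] /=.
  exact: ddiffC.
exact: ddiffD.
Qed.

Lemma ddiff_prod y (I : finType) (f : I -> dexpr R) :
  (forall i, ddiff y (f i)) -> ddiff y (dprod f).
Proof.
move=> fy; rewrite /dprod; elim: (index_enum I) => [|i r IH] /=.
  exact: ddiffC.
exact: ddiffM.
Qed.

Lemma ddiff_mulmx y m n p (M : 'M[dexpr R]_(m, n)) (N : 'M[dexpr R]_(n, p)) :
  (forall i j, ddiff y (M i j)) -> (forall i j, ddiff y (N i j)) ->
  forall i j, ddiff y (dmulmx M N i j).
Proof.
by move=> My Ny i j; rewrite mxE; apply: ddiff_sum => k; exact: ddiffM.
Qed.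

Lemma ddiff_det y n (M : 'M[dexpr R]_n) :
  (forall i j, ddiff y (M i j)) -> ddiff y (ddet M).
Proof.
move=> My; apply: ddiff_sum => s; apply: ddiffM; first exact: ddiffC.
exact: ddiff_prod.
Qed.

Lemma ddiff_invmx y n (M : 'M[dexpr R]_n) :
  (forall i j, ddiff y (M i j)) -> devalmx M y \in unitmx ->
  forall i j, ddiff y (dinvmx M i j).
Proof.
move=> My Mu i j; rewrite mxE; apply: ddiffM.
  apply: differentiableV; first exact: ddiff_det.
  by move: Mu; rewrite unitmxE -deval_det unitfE.
apply: ddiffM; first exact: ddiffC.
by apply: ddiff_det => k l; rewrite !mxE.
Qed.

End Expressions.

(** * The adapted coframe *)

Section AdaptedExpressions.
Context {R : realType}.
Implicit Types (E : dexpr R) (W : 'M[dexpr R]_3) (a b c d : 'I_(3 + 1)).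

Definition dframe : 'M[dexpr R]_3 := \matrix_(a, i) DFrame a i.

(** Coframe components of a 2-form on the orbit space given by its coordinate
    components. *)
Definition dcomp W : 'M[dexpr R]_3 :=
  dmulmx (dmulmx (dinvmx dframe)^T W) (dinvmx dframe).

(** Frame derivatives along the three dual vectors of the orbit space. *)
Definition dgrad E : 'cV[dexpr R]_3 :=
  dmulmx (dinvmx dframe)^T (\col_i DPartial i E).

(** Structure functions of the adapted coframe.  For a < 3 the form e^a comes
    from the orbit space; the last matrix is that of
    de^3 = e^gamma F + dgamma /\ e^3, where the block position of the gradient
    accounts for dgamma /\ e^3. *)
Definition dstruct a : 'M[dexpr R]_(3 + 1) :=
  match fintype.split a with
  | inl a' => block_mx
      (dcomp (\matrix_(i, j)
         dsub (DPartial i (DFrame a' j)) (DPartial j (DFrame a' i))))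
      (const_mx (DConst 0)) (const_mx (DConst 0)) (const_mx (DConst 0))
  | inr _ => block_mx
      (map_mx (DMul (DExp DGamma)) (dcomp (\matrix_(i, j) DFaraday i j)))
      (dgrad DGamma)
      (map_mx (DMul (DConst (-1))) (dgrad DGamma)^T) (const_mx (DConst 0))
  end.

(** Frame derivatives in spacetime of a function of (x^0, x^1, x^2): e_3 is
    proportional to d/dx^3 and the vertical part of the others drops out, so
    this is where the potential disappears from the dual frame. *)
Definition dframe_deriv c E : dexpr R :=
  (col_mx (dgrad E) (const_mx (DConst 0)) : 'cV_(3 + 1)) c 0.

Definition dconnection a b c : dexpr R :=
  DMul (DConst (eta_sign a)) (DMul (DConst 2^-1)
    (DAdd (DMul (DConst (eta_sign a)) (dstruct a b c))
      (DMul (DConst (-1))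
        (DAdd (DMul (DConst (eta_sign b)) (dstruct b a c))
              (DMul (DConst (eta_sign c)) (dstruct c a b)))))).

Definition driemann a b c d : dexpr R :=
  DAdd (dsub (dframe_deriv c (dconnection a b d))
             (dframe_deriv d (dconnection a b c)))
    (DAdd (dsum (fun f => DMul (dconnection a b f) (dstruct f c d)))
          (dsum (fun f =>
             dsub (DMul (dconnection a f c) (dconnection f b d))
                  (DMul (dconnection a f d) (dconnection f b c))))).

Context (frame : ('rV[R]_3 -> 'M[R]_3) -> 'rV[R]_3 -> 'M[R]_3)
  (gamma : 'rV[R]_3 -> R) (g : 'rV[R]_3 -> 'M[R]_3) (A : 'rV[R]_3 -> 'rV[R]_3)
  (U : set 'rV[R]_3).
Local Notation e := (frame (rescaled_metric gamma g)).
Local Notation ev E := (deval frame gamma g (extd A) E).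
Local Notation evmx M := (devalmx frame gamma g (extd A) M).
Local Notation eh := (adapted_coframe gamma A e).
Local Notation diffble := (ddiff frame gamma g (extd A)).
Context (gamma_smooth : smooth_on U gamma).
Context (A_smooth : smooth_mx_on U A).
Context (e_smooth : smooth_mx_on U e).
Context (e_orth : orthonormal_coframe U (rescaled_metric gamma g) e).

Lemma deval_trmx m n (M : 'M[dexpr R]_(m, n)) y : evmx M^T y = (evmx M y)^T.
Proof. exact/esym/matrix.map_trmx. Qed.

Lemma deval_dframe y : evmx dframe y = e y.
Proof. by apply/matrixP => a i; rewrite !mxE. Qed.

Lemma deval_inv_dframe y : U y -> evmx (dinvmx dframe) y = invmx (e y).
Proof.
move=> Uy; rewrite deval_invmx deval_dframe//.
by have [] := e_orth Uy.
Qed.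

Lemma deval_dcomp W y : U y -> (e y)^T *m evmx (dcomp W) y *m e y = evmx W y.
Proof.
move=> Uy; have [eu _] := e_orth Uy.
rewrite !deval_mulmx deval_trmx.
rewrite deval_inv_dframe// !mulmxA -trmx_mul mulVmx// trmx1 mul1mx.
by rewrite -mulmxA mulVmx// mulmx1.
Qed.

Lemma deval_dgrad E y : U y ->
  (e y)^T *m evmx (dgrad E) y = \col_i partial i (ev E) y.
Proof.
move=> Uy; have [eu _] := e_orth Uy.
rewrite !deval_mulmx deval_trmx.
rewrite deval_inv_dframe// !mulmxA -trmx_mul mulVmx// trmx1 mul1mx.
by apply/matrixP => i j; rewrite !mxE.
Qed.

Lemma adapted_coframeE x : let y := lsubmx x in
  eh x = block_mx (e y) 0 (expR (gamma y) *: A y) (expR (gamma y))%:M.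
Proof. by rewrite /adapted_coframe scale_row_mx scalemx1. Qed.

Lemma minkowski_block :
  minkowski = block_mx minkowski 0 0 1%:M :> 'M[R]_(3 + 1).
Proof.
apply/matrixP => i j; rewrite minkowskiE.
case: (split_ordP i) => i' ->; case: (split_ordP j) => j' ->.
- by rewrite block_mxEul minkowskiE eq_lshift.
- by rewrite block_mxEur mxE eq_lrshift.
- by rewrite block_mxEdl mxE eq_rlshift.
- by rewrite block_mxEdr mxE eq_rshift.
Qed.

Lemma adapted_orthonormal :
  orthonormal_coframe (lsubmx @^-1` U) (spacetime_metric gamma g A) eh.
Proof.
move=> x Uy; have [eu eE] := e_orth Uy.
rewrite adapted_coframeE; split.
  rewrite unitmxE det_lblock unitrM -unitmxE eu det_scalar expr1 unitfE.
  by rewrite expR_eq0.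
rewrite /spacetime_metric minkowski_block.
rewrite tr_block_mx !mulmx_block !trmx0 tr_scalar_mx.
rewrite !mulmx0 !mul0mx !addr0 !add0r !mulmx1.
rewrite tr_row_mx mul_col_row trmx1 !mul1mx !mulmx1.
rewrite !scale_block_mx add_block_mx !scaler0 !add0r -eE.
have -> : expR (2 * gamma (lsubmx x)) =
    expR (gamma (lsubmx x)) * expR (gamma (lsubmx x)).
  by rewrite mulr2n mulrDl mul1r expRD.
rewrite mul0mx add0r; congr block_mx.
- by rewrite -scalemxAr [(_ *: _)^T]linearZ/= -scalemxAl scalerA.
- by rewrite mul_mx_scalar [(_ *: _)^T]linearZ/= scalerA.
- by rewrite mul_scalar_mx scalerA.
- by rewrite -scalar_mxM scalemx1.
Qed.

Lemma deval_block m1 m2 n1 n2 (M1 : 'M[dexpr R]_(m1, n1))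
    (M2 : 'M[dexpr R]_(m1, n2)) (M3 : 'M[dexpr R]_(m2, n1))
    (M4 : 'M[dexpr R]_(m2, n2)) y :
  evmx (block_mx M1 M2 M3 M4) y =
    block_mx (evmx M1 y) (evmx M2 y) (evmx M3 y) (evmx M4 y).
Proof. exact: map_block_mx. Qed.

Lemma deval_col m1 m2 n (M1 : 'M[dexpr R]_(m1, n))
    (M2 : 'M[dexpr R]_(m2, n)) y :
  evmx (col_mx M1 M2) y = col_mx (evmx M1 y) (evmx M2 y).
Proof. exact: map_col_mx. Qed.

Lemma deval_zero m n y :
  evmx (const_mx (DConst 0) : 'M[dexpr R]_(m, n)) y = 0.
Proof. by apply/matrixP => i j; rewrite !mxE. Qed.

Lemma deval_dstruct_l (a : 'I_3) y : evmx (dstruct (lshift 1 a)) y = block_mx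
  (evmx (dcomp (\matrix_(i, j)
     dsub (DPartial i (DFrame a j)) (DPartial j (DFrame a i)))) y) 0 0 0.
Proof.
rewrite /dstruct -[lshift 1 a]/(unsplit (inl a)) unsplitK.
by rewrite deval_block !deval_zero.
Qed.

Lemma deval_dstruct_r (a : 'I_1) y : evmx (dstruct (rshift 3 a)) y = block_mx
  (expR (gamma y) *: evmx (dcomp (\matrix_(i, j) DFaraday i j)) y)
  (evmx (dgrad DGamma) y) (- (evmx (dgrad DGamma) y)^T) 0.
Proof.
rewrite /dstruct -[rshift 3 a]/(unsplit (inr a)) unsplitK.
rewrite deval_block deval_zero; congr block_mx; apply/matrixP => i j.
  by rewrite !mxE.
by rewrite !mxE /= mulN1r.
Qed.

(** For a = 3 the undifferentiated A occurs on both sides: in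
    d(e^gamma A) through dgamma /\ A, and in the coframe through
    dgamma /\ e^3.  The two occurrences match, leaving e^gamma F. *)
Lemma adapted_structure x a : U (lsubmx x) ->
  extd (fun z => row a (eh z)) x =
    (eh x)^T *m evmx (dstruct a) (lsubmx x) *m eh x.
Proof.
move=> Uy; set y := lsubmx x.
rewrite [in RHS]adapted_coframeE -/y tr_block_mx trmx0 tr_scalar_mx.
case: (split_ordP a) => a' ->.
  rewrite deval_dstruct_l !mulmx_block.
  rewrite !(mulmx0, mul0mx, addr0) deval_dcomp//.
  have -> : (fun z => row (lshift 1 a') (eh z)) =
      (fun z => row_mx (row a' (e (lsubmx z))) 0).
    apply/funext => z; rewrite adapted_coframeE.
    by rewrite /block_mx rowKu row_row_mx row0.
  rewrite (extd_lsubmx (fun z => row_mx (row a' (e z)) 0)) -/y.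
  have -> : (\col_i partial i
        (fun z => rsubmx (row_mx (row a' (e z)) (0 : 'rV_1)) 0 0) y)
      = 0 :> 'cV[R]_3.
    apply/matrixP => i j; rewrite !mxE (_ : (fun z => _) = cst 0).
      by rewrite /partial derive_cst.
    by apply/funext => z; rewrite row_mxKr mxE.
  rewrite trmx0 oppr0; congr block_mx.
  apply/matrixP => i j; rewrite !mxE deval_sub /=.
  by congr (_ - _); congr (partial _ _ _); apply/funext => z;
    rewrite row_mxKl mxE.
rewrite deval_dstruct_r.
set G := evmx (dgrad DGamma) y.
set P := evmx (dcomp (\matrix_(i, j) DFaraday i j)) y.
pose k z := expR (gamma z); rewrite -/(k y).
have -> : (fun z => row (rshift 3 a') (eh z)) =
    (fun z => row_mx (k (lsubmx z) *: A (lsubmx z)) (k (lsubmx z))%:M).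
  apply/funext => z; rewrite adapted_coframeE.
  by rewrite /block_mx rowKd row_id.
rewrite (extd_lsubmx (fun z => row_mx (k z *: A z) (k z)%:M)) -/y.
have dgam : differentiable gamma y by exact: (gamma_smooth [::] Uy).
have eG : (e y)^T *m G = \col_i partial i gamma y by exact: deval_dgrad.
have eP : (e y)^T *m P *m e y = extd A y.
  by rewrite deval_dcomp//; apply/matrixP => i j; rewrite [LHS]mxE mxE.
have -> : (\col_i partial i
    (fun z => rsubmx (row_mx (k z *: A z) (k z)%:M) 0 0) y) =
    k y *: ((e y)^T *m G).
  rewrite eG; apply/matrixP => i j; rewrite !mxE -partial_expR//.
  by congr (partial _ _ _); apply/funext => z; rewrite row_mxKr mxE.
have -> : extd (fun z => lsubmx (row_mx (k z *: A z) (k z)%:M)) y =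
    k y *: (extd A y + wedge ((e y)^T *m G)^T (A y)).
  under eq_fun do rewrite row_mxKl.
  rewrite extd_expR_scale//; last by move=> j; exact: (A_smooth 0 j [::] Uy).
  rewrite eG; congr (_ *: (_ + wedge _ _)).
  by apply/rowP => i; rewrite !mxE.
rewrite -eP !mulmx_block !(mulmx0, mul0mx, addr0, add0r); congr block_mx.
- rewrite wedgeE trmxK trmx_mul trmxK mulmxA [(k y *: A y)^T]linearZ/=.
  rewrite -!scalemxAr -!scalemxAl mulmxN mulmxDl -scalemxAl.
  by rewrite -scalemxAl mulNmx scalerN scalerDr scalerBr addrA addrAC.
- by rewrite mul_mx_scalar.
- rewrite [(k y *: _)^T]linearZ/= trmx_mul trmxK.
  by rewrite mul_scalar_mx scalerN mulNmx scalemxAl.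
Qed.

Lemma dcomp_antisym W y :
  (evmx W y)^T = - evmx W y -> (evmx (dcomp W) y)^T = - evmx (dcomp W) y.
Proof.
move=> WN; rewrite !deval_mulmx deval_trmx !trmx_mul WN trmxK.
by rewrite mulNmx mulmxN mulmxA.
Qed.

Lemma dstruct_antisym a b c y : ev (dstruct a b c) y = - ev (dstruct a c b) y.
Proof.
suff WN : (evmx (dstruct a) y)^T = - evmx (dstruct a) y.
  by move/matrixP/(_ c b): WN; rewrite !mxE.
have dcompN W : (forall i j, ev (W i j) y = - ev (W j i) y) ->
    (evmx (dcomp W) y)^T = - evmx (dcomp W) y.
  move=> WN; apply: dcomp_antisym; apply/matrixP => i j.
  by rewrite [LHS]mxE [LHS]mxE WN [RHS]mxE [in RHS]mxE.
case: (split_ordP a) => a' ->.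
  rewrite deval_dstruct_l tr_block_mx !trmx0 opp_block_mx.
  rewrite !oppr0 dcompN// => i j.
  by rewrite !mxE !deval_sub opprB.
rewrite deval_dstruct_r tr_block_mx opp_block_mx trmx0 oppr0.
rewrite opprK linearN/= trmxK linearZ/= dcompN ?scalerN// => i j.
by rewrite !mxE /= !mxE opprB.
Qed.

(** df = (D_c f) e^c holds with D_3 f = 0, and the components of e^c for
    c < 3 do not involve A. *)
Lemma partial_adapted x E i : U (lsubmx x) ->
  partial i (fun z => ev E (lsubmx z)) x =
    \sum_c eh x c i * ev (dframe_deriv c E) (lsubmx x).
Proof.
move=> Uy; set y := lsubmx x.
transitivity (((eh x)^T *m
    evmx (col_mx (dgrad E) (const_mx (DConst 0)) : 'cV_(3 + 1)) y) i 0);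
  last first.
  rewrite mxE; apply: eq_bigr => c _; rewrite mxE; congr (_ * _).
  by rewrite [LHS]mxE.
rewrite deval_col deval_zero.
rewrite adapted_coframeE -/y tr_block_mx mul_block_col !mulmx0 !addr0.
rewrite deval_dgrad// trmx0 mul0mx.
case: (split_ordP i) => i' ->.
  by rewrite col_mxEu mxE -partial_lsubmx_l.
by rewrite col_mxEd mxE -[RHS](partial_lsubmx_r (ev E) x i').
Qed.

Lemma ddiff_frame y (a i : 'I_3) : U y -> diffble y (DFrame a i).
Proof. by move=> Uy; exact: (e_smooth a i [::] Uy). Qed.

Lemma ddiff_dinvmx y i j : U y -> diffble y (dinvmx dframe i j).
Proof.
move=> Uy; apply: ddiff_invmx; last first.
  by rewrite deval_dframe; have [] := e_orth Uy.
by move=> a k; rewrite mxE; exact: ddiff_frame.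
Qed.

Lemma ddiff_dcomp y W : U y -> (forall i j, diffble y (W i j)) ->
  forall i j, diffble y (dcomp W i j).
Proof.
move=> Uy Wy; apply: ddiff_mulmx => [i j|i j]; last exact: ddiff_dinvmx.
by apply: ddiff_mulmx => // k l; rewrite mxE; exact: ddiff_dinvmx.
Qed.

(** The only reciprocal in the structure functions is that of the determinant
    of the coframe, which does not vanish on U. *)
Lemma ddiff_dstruct y a b c : U y -> diffble y (dstruct a b c).
Proof.
move=> Uy.
have ddiff_grad i j : diffble y (dgrad DGamma i j).
  apply: ddiff_mulmx => [k l|k l]; rewrite mxE; first exact: ddiff_dinvmx.
  exact: (gamma_smooth [:: k] Uy).
case: (split_ordP a) => a' ->.
  rewrite /dstruct -[lshift 1 a']/(unsplit (inl a')) unsplitK.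
  case: (split_ordP b) => b' ->;
    case: (split_ordP c) => c' ->;
    rewrite ?(block_mxEul, block_mxEur, block_mxEdl, block_mxEdr);
    try by (rewrite mxE; exact: ddiffC).
  apply: ddiff_dcomp => // i j; rewrite mxE; apply: ddiff_sub.
    exact: (e_smooth a' j [:: i] Uy).
  exact: (e_smooth a' i [:: j] Uy).
rewrite /dstruct -[rshift 3 a']/(unsplit (inr a')) unsplitK.
case: (split_ordP b) => b' ->;
  case: (split_ordP c) => c' ->;
  rewrite ?(block_mxEul, block_mxEur, block_mxEdl, block_mxEdr).
- rewrite mxE; apply: ddiffM.
    exact: (differentiable_expR_comp (gamma_smooth [::] Uy)).
  apply: ddiff_dcomp => // i j; rewrite mxE /ddiff /=.
  rewrite (_ : (fun z => _) =
    partial i (fun z => A z 0 j) - partial j (fun z => A z 0 i)).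
    apply: differentiableB.
      exact: (A_smooth 0 j [:: i] Uy).
    exact: (A_smooth 0 i [:: j] Uy).
  by apply/funext => z; rewrite mxE.
- exact: ddiff_grad.
- rewrite mxE; apply: ddiffM; first exact: ddiffC.
  by rewrite mxE; exact: ddiff_grad.
- by rewrite mxE; exact: ddiffC.
Qed.

Lemma ddiff_dconnection y a b c : U y -> diffble y (dconnection a b c).
Proof.
move=> Uy; have diffC p k l m : diffble y (DMul (DConst p) (dstruct k l m)).
  by apply: ddiffM; [exact: ddiffC|exact: ddiff_dstruct].
do 2![apply: ddiffM; first exact: ddiffC].
apply: ddiffD => //; apply: ddiffM; first exact: ddiffC.
exact: ddiffD.
Qed.

Lemma differentiable_pullback (f : 'rV[R]_3 -> R) (x : 'rV[R]_(3 + 1)) :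
  differentiable f (lsubmx x) -> differentiable (fun z => f (lsubmx z)) x.
Proof.
move=> df; apply: (@differentiable_comp _ _ _ _ lsubmx f) => //.
exact: differentiable_lsubmx.
Qed.

Lemma adapted_differentiable x a i : U (lsubmx x) ->
  differentiable (fun z => eh z a i) x.
Proof.
move=> Uy; pose B z := block_mx (e z) (0 : 'cV_3) (expR (gamma z) *: A z)
  (expR (gamma z))%:M a i.
have -> : (fun z => eh z a i) = (fun z => B (lsubmx z)).
  by apply/funext => z; rewrite adapted_coframeE.
apply: differentiable_pullback; rewrite /B => {B}.
have dk := differentiable_expR_comp (gamma_smooth [::] Uy).
case: (split_ordP a) => a' ->; case: (split_ordP i) => i' ->.
- under eq_fun do rewrite block_mxEul.
  exact: (e_smooth a' i' [::] Uy).
- under eq_fun do rewrite block_mxEur mxE.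
  exact: differentiable_cst.
- under eq_fun do rewrite block_mxEdl mxE.
  by apply: differentiableM => //; exact: (A_smooth a' i' [::] Uy).
- rewrite (ord1 a') (ord1 i').
  by under eq_fun do rewrite block_mxEdr mxE eqxx mulr1n.
Qed.

Lemma adapted_riemann :
  riemann_components (lsubmx @^-1` U) (spacetime_metric gamma g A) eh
    (fun a b c d x => ev (driemann a b c d) (lsubmx x)).
Proof.
have -> : (fun a b c d x => ev (driemann a b c d) (lsubmx x)) =
  (fun a b c d (x : 'rV_(3 + 1)) => frame_curvature
    (fun k l m => ev (dconnection k l m) (lsubmx x))
    (fun k l m p => ev (dframe_deriv k (dconnection l m p)) (lsubmx x))
    (fun k l m => ev (dstruct k l m) (lsubmx x)) a b c d).
  apply/funext => a; apply/funext => b; apply/funext => c; apply/funext => d.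
  apply/funext => x; rewrite /driemann /frame_curvature.
  rewrite [LHS]/= !mulN1r -/(deval _ _ _ _).
  rewrite !deval_sum; congr (_ + (_ + _)).
  by apply: eq_bigr => f _; rewrite deval_sub.
apply: (@riemann_moving_frame _ _ _ _ _
  (fun k l m x => ev (dstruct k l m) (lsubmx x))
  (fun k l m x => ev (dconnection k l m) (lsubmx x))
  (fun k l m p x => ev (dframe_deriv k (dconnection l m p)) (lsubmx x))).
- exact: adapted_orthonormal.
- by move=> x a i; exact: adapted_differentiable.
- by move=> x a b c _; exact: dstruct_antisym.
- move=> x a Ux; rewrite adapted_structure//; congr (_ *m _ *m _).
  by apply/matrixP => b c; rewrite !mxE.
- by [].
- move=> x a b c Ux; apply: (differentiable_pullback (f := ev _)).
  exact: ddiff_dconnection.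
- by move=> x a b c i Ux; exact: partial_adapted.
Qed.

End AdaptedExpressions.

Theorem lemma4p1 (R : realType) :
  exists E : 'I_(3 + 1) -> 'I_(3 + 1) -> 'I_(3 + 1) -> 'I_(3 + 1) -> dexpr R,
  forall (U : set 'rV[R]_3) (gamma : 'rV[R]_3 -> R) (g : 'rV[R]_3 -> 'M[R]_3)
    (A : 'rV[R]_3 -> 'rV[R]_3)
    (frame : ('rV[R]_3 -> 'M[R]_3) -> 'rV[R]_3 -> 'M[R]_3),
  open U ->
  smooth_on U gamma ->
  smooth_mx_on U g ->
  (forall y, U y -> lorentzian (g y)) ->
  smooth_mx_on U A ->
  smooth_mx_on U (frame (rescaled_metric gamma g)) ->
  orthonormal_coframe U (rescaled_metric gamma g)
    (frame (rescaled_metric gamma g)) ->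
  riemann_components (lsubmx @^-1` U)
    (spacetime_metric gamma g A)
    (adapted_coframe gamma A (frame (rescaled_metric gamma g)))
    (fun a b c d x => deval frame gamma g (extd A) (E a b c d) (lsubmx x)).
Proof.
exists driemann => U gamma g A frame _ gamma_smooth _ _ A_smooth e_smooth eo.
exact: adapted_riemann.
Qed.
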